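(* Let $X$ be a semilattice and $G$ an Abelian group. For $x\in X$ let $I(x)=\{z\wedge x:z\in X\}$, and let $\mathscr R_X$ be the ring of subsets of $X$ generated by the sets $I(x)$, $x\in X$. The groups $\mathfrak F(X,G)$ and $\mathfrak F_m(\mathscr R_X,G)$ correspond isomorphically via the identity $$\mu(I(x))=f(x),\qquad x\in X .$$ Moreover, if $\mu\in\mathfrak F_m(\mathscr R_X,G)$ and $f\in\mathfrak F(X,G)$ satisfy this identity, then: (i) $f\in\mathfrak F_m(X,G)$ if and only if $\mu\big(\bigcup_{x\in a}I(x)\big)=\mu\big(I(\vee a)\big)$ for every finite $a\subseteq X$ whose least upper bound $\vee a$ exists in $X$; (ii) if $G$ is partially ordered, then $\mu$ is positive if and only if $f$ satisfies the condition: $T(\xi)\le f(x)$ for all $\xi\in\Xi$ and $x\in X$ with $\xi\le[x]$, where $T:\Xi\to G$ is the canonical representation of $f$.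
   Context: A semilattice is a commutative idempotent semigroup $(X,\wedge)$, ordered by $x\le y$ iff $x=x\wedge y$. $[N]=\{1,\ldots,N\}$ and $\nu(b)=(-1)^{1+|b|}$ for a finite set $b$. $\mathfrak F(X,G)$ is the group (pointwise addition) of all functions $X\to G$. For a semilattice $Y$, $f:Y\to G$ is modular, $f\in\mathfrak F_m(Y,G)$, if $f\big(\bigvee_{1\le n\le N}y_n\big)=\sum_{\emptyset\ne b\subseteq[N]}\nu(b)f\big(\bigwedge_{n\in b}y_n\big)$ for all $y_1,\ldots,y_N\in Y$ whose least upper bound exists in $Y$. The ring of sets $\mathscr R_X$ is viewed as a lattice under $\cap,\cup$. Canonical space: on finite sequences (including the empty one) of elements of $X$ put $\langle x_1,\ldots,x_N\rangle\le\langle z_1,\ldots,z_M\rangle$ if for every $n\in[N]$ there is $m\in[M]$ with $x_n\le z_m$ (so the empty sequence is below every sequence). $\Xi$ is the quotient of the set of finite sequences by the equivalence relation ($\le$ and $\ge$) induced by this preorder, with the induced partial order; $[x_1,\ldots,x_N]$ is the class of $\langle x_1,\ldots,x_N\rangle$. The canonical representation of $f:X\to G$ is the (well-defined) function $T:\Xi\to G$, $T([x_1,\ldots,x_N])=\sum_{\emptyset\ne b\subseteq[N]}\nu(b)f\big(\bigwedge_{n\in b}x_n\big)$, with value $0$ at the class of the empty sequence. ''$G$ partially ordered'' means that $G$ is a partially ordered Abelian group; $\mu$ is positive if $\mu(A)\ge0$ for all $A\in\mathscr R_X$. *)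

(* Defs.v *)
From HB Require Import structures.
From mathcomp Require Import all_boot all_order all_algebra.
From mathcomp Require Import generic_quotient.
From mathcomp Require Import boolp classical_sets functions cardinality.
From mathcomp Require Import measurable_structure.

Set Implicit Arguments.
Unset Strict Implicit.
Unset Printing Implicit Defensive.

Import Order.TTheory GRing.Theory.

Local Open Scope classical_set_scope.
Local Open Scope ring_scope.

Section InclusionExclusion.
Context {d : Order.disp_t} {Y : meetSemilatticeType d} {G : zmodType}.
Implicit Types (f : Y -> G) (s : seq Y).

Definition nu (I : finType) (b : {set I}) : int := (-1) ^+ (1 + #|b|)%N.

(* The value of f at the meet of a nonempty sequence.  As Y need not have a
   top element, the meet is seeded with the first entry; the value at the
   empty sequence is a dummy. *)
Definition meet_val f s : G :=
  if s is x :: s' then f (\big[Order.meet/x]_(z <- s') z) else 0.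

Definition incl_excl f N (y : 'I_N -> Y) : G :=
  \sum_(b : {set 'I_N} | b != finset.set0)
    meet_val f [seq y n | n <- enum b] *~ nu b.

(* N = 0 is allowed: if Y has a least element, f vanishes at it. *)
Definition modular f : Prop :=
  forall N (y : 'I_N -> Y) (u : Y),
    supremums (range y) u -> f u = incl_excl f y.

End InclusionExclusion.

Section ModularFunctions.
Context {d : Order.disp_t} (Y : meetSemilatticeType d) (G : zmodType).

Definition modular_pred : {pred Y -> G} := fun f => `[< modular f >].

Fact modular_zmod_closed : zmod_closed modular_pred.
Proof.
have mvB (f g : Y -> G) s : meet_val (f - g) s = meet_val f s - meet_val g s.
  by case: s => [|x s] /=; rewrite ?subr0.
split=> [|f g /asboolP fm /asboolP gm]; apply/asboolP => N y u yu.
  rewrite /incl_excl big1 // => b _.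
  have -> : meet_val (0 : Y -> G) [seq y n | n <- enum b] = 0.
    by case: [seq y n | n <- enum b].
  by rewrite mul0rz.
rewrite -[LHS]/(f u - g u) (fm _ _ _ yu) (gm _ _ _ yu) /incl_excl -sumrB.
by apply: eq_bigr => b _; rewrite mvB mulrzBl.
Qed.

HB.instance Definition _ :=
  GRing.isZmodClosed.Build (Y -> G) modular_pred modular_zmod_closed.

Record modular_fun :=
  ModularFun { modular_val :> Y -> G; _ : modular_val \in modular_pred }.

HB.instance Definition _ := [isSub for modular_val].
HB.instance Definition _ := [Choice of modular_fun by <:].
HB.instance Definition _ := [SubChoice_isSubZmodule of modular_fun by <:].

End ModularFunctions.

Section RingOfSets.
Context {d : Order.disp_t} (X : meetSemilatticeType d).

Definition ideal (x : X) : set X := [set (z `&` x)%O | z in [set: X]].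

(* <<r _ >> is the least family containing the empty set and closed under
   binary unions and differences. *)
Definition ring_pred : {pred set X} := fun A => A \in <<r range ideal >>.

Lemma ring_predP A : reflect (<<r range ideal >> A) (A \in ring_pred).
Proof. by apply: (iffP idP) => [/set_mem|/mem_set]. Qed.

Fact ring_predI : {in ring_pred &, forall A B, (A `&` B)%O \in ring_pred}.
Proof.
move=> A B /ring_predP RA /ring_predP RB; apply/ring_predP.
rewrite -[Order.meet A B]/(A `&` B) -setDD.
by do 2?[apply: setringD => //].
Qed.

Fact ring_predU : {in ring_pred &, forall A B, (A `|` B)%O \in ring_pred}.
Proof.
move=> A B /ring_predP RA /ring_predP RB; apply/ring_predP.
exact: setringU.
Qed.

HB.instance Definition _ :=
  Order.isLatticeClosed.Build _ (set X) ring_pred ring_predI ring_predU.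

Record ringR := RingR { ringR_val :> set X; _ : ringR_val \in ring_pred }.

HB.instance Definition _ := [isSub for ringR_val].
HB.instance Definition _ := [Choice of ringR by <:].
HB.instance Definition _ :=
  [SubChoice_isSubLattice of ringR by <: with set_display].

Fact ideal_in_ring x : ideal x \in ring_pred.
Proof. by apply/ring_predP; apply: sub_setring; exists x. Qed.

Lemma ringR_meetE (A B : ringR) : ringR_val (A `&` B)%O = A `&` B.
Proof. by []. Qed.

Lemma ringR_joinE (A B : ringR) : ringR_val (A `|` B)%O = A `|` B.
Proof. by []. Qed.

Lemma ringR_leE (A B : ringR) : (A <= B)%O <-> A `<=` B.
Proof. by split=> /asboolP. Qed.

Definition idealR x : ringR := RingR (ideal_in_ring x).

Fact bigcup_in_ring (a : set X) :
  finite_set a -> \bigcup_(x in a) ideal x \in ring_pred.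
Proof.
move=> fa; apply/ring_predP; apply: setring_fin_bigcup => // x _.
exact/ring_predP/ideal_in_ring.
Qed.

Definition bigcup_idealR (a : set X) (fa : finite_set a) : ringR :=
  RingR (bigcup_in_ring fa).

End RingOfSets.

Section CanonicalSpace.
Context {d : Order.disp_t} (X : meetSemilatticeType d).
Implicit Types s t : seq X.

Definition seqle s t := all (fun x => has (fun z => (x <= z)%O) t) s.

Lemma seqleP s t :
  reflect (forall x, x \in s -> exists2 z, z \in t & (x <= z)%O) (seqle s t).
Proof.
apply: (iffP allP) => h x /h; first by case/hasP => z; exists z.
by case=> z zt xz; apply/hasP; exists z.
Qed.

Fact seqle_refl : reflexive seqle.
Proof. by move=> s; apply/seqleP => x xs; exists x. Qed.

Fact seqle_trans : transitive seqle.
Proof.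
move=> t s u /seqleP st /seqleP tu; apply/seqleP => x /st[y /tu[z zu yz] xy].
by exists z => //; apply: le_trans yz.
Qed.

Definition seqequiv s t := seqle s t && seqle t s.

Fact seqequiv_refl : reflexive seqequiv.
Proof. by move=> s; rewrite /seqequiv seqle_refl. Qed.

Fact seqequiv_sym : symmetric seqequiv.
Proof. by move=> s t; rewrite /seqequiv andbC. Qed.

Fact seqequiv_trans : transitive seqequiv.
Proof.
move=> t s u /andP[st ts] /andP[tu ut].
by rewrite /seqequiv (seqle_trans st tu) (seqle_trans ut ts).
Qed.

Canonical seqequiv_rel :=
  EquivRel seqequiv seqequiv_refl seqequiv_sym seqequiv_trans.

Definition Xi : Type := {eq_quot seqequiv}%qT.

HB.instance Definition _ := Choice.on Xi.
HB.instance Definition _ : EqQuotient _ seqequiv Xi := EqQuotient.on Xi.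

Definition Xi_class s : Xi := (\pi_Xi s)%qT.

Definition Xi_le (xi eta : Xi) := seqle (repr xi) (repr eta).

Lemma repr_Xi_class s : seqequiv (repr (Xi_class s)) s.
Proof. by apply/eqmodP; rewrite reprK. Qed.

Fact Xi_le_refl : reflexive Xi_le.
Proof. by move=> xi; apply: seqle_refl. Qed.

Fact Xi_le_anti : antisymmetric Xi_le.
Proof.
by move=> xi eta h; rewrite -(reprK xi) -(reprK eta); apply/eqmodP.
Qed.

Fact Xi_le_trans : transitive Xi_le.
Proof. by move=> xi eta zeta; apply: seqle_trans. Qed.

HB.instance Definition _ :=
  Order.Le_isPOrder.Build d Xi Xi_le_refl Xi_le_anti Xi_le_trans.

Lemma Xi_class_le s t : (Xi_class s <= Xi_class t)%O = seqle s t.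
Proof.
have /andP[s1 s2] := repr_Xi_class s; have /andP[t1 t2] := repr_Xi_class t.
rewrite -[LHS]/(seqle _ _); apply/idP/idP => h.
  exact: seqle_trans (seqle_trans s2 h) t1.
exact: seqle_trans (seqle_trans s1 h) t2.
Qed.

End CanonicalSpace.

Section CanonicalRepresentation.
Context {d : Order.disp_t} {X : meetSemilatticeType d} {G : zmodType}.
Implicit Types (f : X -> G) (s t : seq X).

Definition canonical_rep f (xi : Xi X) : G :=
  incl_excl f (tnth (in_tuple (repr xi))).

(* The rest of this section shows that canonical_rep does not depend on the
   chosen representatives, by way of a recursion on the sequence. *)
Fixpoint ie_rec f s : G :=
  if s is x :: s' then
    f x + ie_rec f s' - ie_rec (fun z => f (x `&` z)%O) s'
  else 0.

Lemma ie_rec_ext f g s : f =1 g -> ie_rec f s = ie_rec g s.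
Proof.
elim: s f g => //= x s IH f g fg; rewrite fg (IH f g) //.
by congr (_ - _); apply: IH => z; rewrite fg.
Qed.

Lemma enum_ordS n (b : {set 'I_n.+1}) :
  enum b = (if ord0 \in b then cons ord0 else id)
    [seq lift ord0 i | i <- enum (lift ord0 @^-1: b)%SET].
Proof.
have enumE (m : nat) (c : {set 'I_m}) : enum c = [seq i <- enum 'I_m | i \in c].
  by rewrite enumT.
rewrite !enumE enum_ordSl /= filter_map.
rewrite (@eq_filter _ (preim (lift ord0) (mem b))
  (fun i => i \in (lift ord0 @^-1: b)%SET)); last by move=> i; rewrite /= !inE.
by case: ifP.
Qed.

Lemma meet_val_cons f x s :
  meet_val f (x :: s) = (if s is [::] then f x else
     meet_val (fun z => f (x `&` z)%O) s).
Proof.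
case: s => [|y s] /=; first by rewrite big_nil.
congr f; rewrite big_cons /=; elim: s => [|z s IH].
  by rewrite !big_nil meetC.
by rewrite !big_cons meetCA IH meetCA.
Qed.

Lemma incl_exclS f N (y : 'I_N.+1 -> X) :
  incl_excl f y = f (y ord0) + incl_excl f (y \o lift ord0)
    - incl_excl (fun z => f (y ord0 `&` z)%O) (y \o lift ord0).
Proof.
rewrite /incl_excl.
have lift_inj' := @lift_inj N.+1 ord0.
have liftK (c : {set 'I_N}) : (lift ord0 @^-1: (lift ord0 @: c))%SET = c.
  by apply/setP => i; rewrite !inE mem_imset.
have notin0 (c : {set 'I_N}) : ord0 \notin (lift ord0 @: c)%SET.
  by apply/imsetP => -[i _].
have lift0K (c : {set 'I_N}) :
    (lift ord0 @^-1: (ord0 |: lift ord0 @: c))%SET = c.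
  by apply/setP => i; rewrite !inE mem_imset // eq_sym (negPf (neq_lift _ _)).
rewrite (bigID (fun b : {set 'I_N.+1} => ord0 \in b)) /=.
rewrite (reindex_onto (fun c : {set 'I_N} => (ord0 |: lift ord0 @: c)%SET)
  (fun b => (lift ord0 @^-1: b)%SET)) /=; last first.
  move=> b /andP[_ b0]; apply/setP => i; rewrite !inE.
  case: (unliftP ord0 i) => [j|] ->; last by rewrite eqxx b0.
  by rewrite mem_imset // inE eq_sym (negPf (neq_lift _ _)).
rewrite [X in _ + X = _](reindex_onto (fun c : {set 'I_N} => (lift ord0 @: c)%SET)
  (fun b => (lift ord0 @^-1: b)%SET)) /=; last first.
  move=> b /andP[_ b0]; apply/setP => i.
  case: (unliftP ord0 i) => [j|] ->; first by rewrite mem_imset // inE.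
  by rewrite (negPf b0); apply/negbTE.
rewrite addrAC; congr (_ + _).
- rewrite (bigD1 finset.set0) /=; last first.
    rewrite lift0K eqxx andbT setU11 andbT.
    by apply/set0Pn; exists ord0; rewrite setU11.
  congr (_ + _).
    rewrite enum_ordS setU11 lift0K enum_set0 /= big_nil /nu imset0 finset.setU0 cards1.
    by rewrite mulr1z.
  rewrite -sumrN; apply: eq_big => [c|c /andP[_ c0]].
    rewrite lift0K eqxx andbT setU11 andbT.
    by case: set0Pn => // -[]; exists ord0; rewrite setU11.
  rewrite enum_ordS setU11 lift0K map_cons meet_val_cons -map_comp.
  have : enum c != [::] by rewrite -size_eq0 -cardE cards_eq0.
  case E : [seq _ | n <- enum c] => [|z s]; first by case: (enum c) E.
  move=> _; rewrite -mulrNz; congr (_ *~ _).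
  rewrite /nu cardsU1 notin0 card_imset //.
  by rewrite [LHS]exprD expr1 mulN1r.
apply: eq_big => [c|c /andP[_ c0]].
  rewrite notin0 liftK eqxx !andbT.
  by rewrite -finset.cards_eq0 card_imset // finset.cards_eq0.
rewrite enum_ordS (negPf (notin0 c)) liftK /= -map_comp.
by rewrite /nu card_imset.
Qed.

Lemma incl_excl_ext f N (y z : 'I_N -> X) :
  y =1 z -> incl_excl f y = incl_excl f z.
Proof.
by move=> yz; apply: eq_bigr => b _; congr (meet_val _ _ *~ _); apply: eq_map.
Qed.

Lemma incl_excl_rec f s : incl_excl f (tnth (in_tuple s)) = ie_rec f s.
Proof.
elim: s f => [|x s IH] f.
  rewrite /incl_excl big_pred0 // => b; apply/negbTE; rewrite negbK.
  by apply/eqP/setP => -[].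
rewrite /= incl_exclS (tnth_nth x) /= -!IH.
have h : tnth (in_tuple (x :: s)) \o lift ord0 =1 tnth (in_tuple s).
  by move=> i /=; rewrite !(tnth_nth x).
by rewrite !(incl_excl_ext _ h).
Qed.

Lemma ie_rec_move f x s t : ie_rec f (s ++ x :: t) = ie_rec f (x :: s ++ t).
Proof.
elim: s f => //= y s IH f; rewrite !IH /= (meetC y x).
rewrite (@ie_rec_ext (fun z => f (y `&` (x `&` z))%O)
  (fun z => f (x `&` (y `&` z))%O)); last by move=> z; rewrite meetCA.
set a := ie_rec _ _; set b := ie_rec _ _; set c := ie_rec _ _.
set e := ie_rec _ _; rewrite !opprB !opprD !addrA.
by rewrite [LHS](ACl (2*1*3*7*5*6*4)%AC).
Qed.

Lemma ie_rec_dom f x s : has (fun z => (x <= z)%O) s ->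
  ie_rec (fun z => f (x `&` z)%O) s = f x.
Proof.
case/hasP => z /path.splitPr[s1 s2] xz.
rewrite ie_rec_move /= (meet_idPl xz).
rewrite (@ie_rec_ext (fun w => f (x `&` (z `&` w))%O)
  (fun w => f (x `&` w)%O)) ?addrK // => w.
by rewrite meetA (meet_idPl xz).
Qed.

Lemma ie_rec_absorb f s t : seqle s t -> ie_rec f (s ++ t) = ie_rec f t.
Proof.
elim: s => //= x s IH /andP[xt st]; rewrite IH // ie_rec_dom.
  by rewrite addrAC subrr add0r.
by rewrite has_cat xt orbT.
Qed.

Lemma ie_rec_catC f s t : ie_rec f (s ++ t) = ie_rec f (t ++ s).
Proof.
elim: s f t => [|x s IH] f t; first by rewrite cats0.
by rewrite ie_rec_move /= !IH.
Qed.

Lemma canonical_repE f s :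
  canonical_rep f (Xi_class s) = incl_excl f (tnth (in_tuple s)).
Proof.
rewrite /canonical_rep !incl_excl_rec.
have /andP[rs sr] := repr_Xi_class s.
by rewrite -(ie_rec_absorb f rs) ie_rec_catC ie_rec_absorb.
Qed.

End CanonicalRepresentation.

Record partially_ordered_group (G : zmodType) (le : rel G) : Prop := {
  pog_refl : reflexive le;
  pog_anti : antisymmetric le;
  pog_trans : transitive le;
  pog_addr : forall x y z : G, le x y -> le (x + z) (y + z)
}.

(* Main.v *)
(* The indicators of the ideals I(x) are linearly independent over the integers:
   at a maximal x occurring in a vanishing combination, only the terms carried
   by x are nonzero.  Hence x |-> f(x) extends to a homomorphism on their span,
   which contains the indicators of all ring sets; this extension is mu.
   Uniqueness and positivity are checked on cells, i.e. differences of an ideal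
   and finitely many ideals: since I(x) and I(y) meet in I(x /\ y), every ring
   set is a finite disjoint union of cells, and
   mu(I(x) \ (I(y_1) u ... u I(y_N))) = f(x) - T([x /\ y_1, ..., x /\ y_N]). *)
Require Import Defs.
From HB Require Import structures.
From mathcomp Require Import all_boot all_order all_algebra.
From mathcomp Require Import boolp classical_sets functions cardinality.
From mathcomp Require Import measurable_structure.

Set Implicit Arguments.
Unset Strict Implicit.
Unset Printing Implicit Defensive.

Import Order.TTheory GRing.Theory.
Local Open Scope classical_set_scope.
Local Open Scope ring_scope.

(** * Cells and induction over the ring of sets *)

Section Cells.
Context {d : Order.disp_t} {X : meetSemilatticeType d}.
Implicit Types (x y p q : X) (s t : seq X) (A B : set X).

Lemma idealP x p : ideal x p <-> (p <= x)%O.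
Proof.
split=> [[z _ <-]|px]; first exact: leIr.
by exists p => //; apply/meet_idPl.
Qed.

(** This is [I(x)] minus the union of the ideals of the entries of [s]. The entries need not lie
    below [x], so removing one more ideal only extends the list. *)
Definition cell x s : set X :=
  [set p | (p <= x)%O && ~~ has (fun y => (p <= y)%O) s].

Lemma cell_nil x : cell x [::] = ideal x.
Proof.
apply/seteqP; split=> p; first by case/andP=> px _; apply/idealP.
by move/idealP => px; rewrite /cell /= px.
Qed.

(** Inside [cell x s], lying in [I(y)] amounts to lying in [I(x /\ y)]. This recursion, with the
    same [s] in both cells on the right, drives the later inductions on lists. *)
Lemma cell_cons x y s : cell x (y :: s) = cell x s `\` cell (x `&` y)%O s.
Proof.
apply/seteqP; split=> p; rewrite /cell /= lexI.
  by case/andP=> ->; rewrite negb_or => /andP[/negPf-> ->]; split.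
by case=> /andP[-> ns]; rewrite negb_or ns /= !andbT => /negP.
Qed.

Lemma sub_cell_meet x y s : cell (x `&` y)%O s `<=` cell x s.
Proof. by move=> p; rewrite /cell /= lexI => /andP[/andP[-> _] ->]. Qed.

Lemma cell_split x y s :
  cell x s = cell (x `&` y)%O s `|` cell x (y :: s).
Proof. by rewrite cell_cons setUC setDKU//; apply: sub_cell_meet. Qed.

Lemma cell_in_ring x s : cell x s \in @ring_pred _ X.
Proof.
apply/ring_predP; elim: s x => [|y s IH] x.
  by rewrite cell_nil; apply/ring_predP/ideal_in_ring.
by rewrite cell_cons; apply: setringD; apply: IH.
Qed.

(** Membership in [A] depends only on which ideals of entries of [s] contain the point. One
    implication suffices, the premise being symmetric in [p] and [q]. *)
Definition decided_by s A := forall p q,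
  (forall y, y \in s -> (p <= y)%O = (q <= y)%O) -> A p -> A q.

(** The sets with such an [s] form a ring containing every ideal; concatenation of lists serves both
    unions and differences. The covering clause keeps [A] inside finitely many ideals, so that cells
    can exhaust it. *)
Lemma ring_decided A : <<r range (@ideal _ X) >> A ->
  exists s, decided_by s A /\ forall p, A p -> has (fun y => (p <= y)%O) s.
Proof.
pose decided : set (set X) := [set A | exists s, decided_by s A /\
  forall p, A p -> has (fun y => (p <= y)%O) s].
suff H : <<r range (@ideal _ X) >> `<=` decided by exact: H.
apply: smallest_sub => [|_ [x _ <-]]; last first.
  exists [:: x]; split=> [p q pq /idealP px|p /idealP /= -> //].
  by apply/idealP; rewrite -pq ?mem_head.
split=> [|A1 A2 [s [ds bs]] [t [dt bt]]|A1 A2 [s [ds bs]] [t [dt bt]]].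
- by exists [::]; split.
- exists (s ++ t); split=> [p q pq|p].
    by case=> [/ds h|/dt h]; [left|right]; apply: h => y ys; apply: pq;
      rewrite mem_cat ys ?orbT.
  by rewrite has_cat => -[/bs ->//|/bt ->]; rewrite orbT.
- exists (s ++ t); split=> [p q pq [A1p A2p]|p [/bs]]; last first.
    by rewrite has_cat => ->.
  split; first by apply: ds A1p => y ys; apply: pq; rewrite mem_cat ys.
  move=> A2q; apply: A2p; apply: dt A2q => y ys; symmetry; apply: pq.
  by rewrite mem_cat ys orbT.
Qed.

Section RingInd.
Variable P : set X -> Prop.
Hypothesis P0 : P set0.
Hypothesis Pcell : forall x s, P (cell x s).
Hypothesis PU : forall A B, A `&` B = set0 -> P A -> P B -> P (A `|` B).

Let P_cell_decided t x s A :
  (forall p q, cell x s p -> cell x s q ->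
    (forall y, y \in t -> (p <= y)%O = (q <= y)%O) -> A p -> A q) ->
  P (A `&` cell x s).
Proof.
elim: t x s => [|y t IH] x s dA.
  have [[p [Ap cp]]|nA] := pselect (exists p, A p /\ cell x s p).
    rewrite setIidr; first exact: Pcell.
    by move=> q cq; apply: dA Ap.
  suff -> : A `&` cell x s = set0 by [].
  by apply/seteqP; split=> // p Ap; apply: nA; exists p.
rewrite (cell_split x y) setIUr; apply: PU.
- rewrite setIACA cell_cons; apply/seteqP; split=> // p.
  by case=> _ [h [_]].
- apply: IH => p q cp cq pq; apply: dA => [||z];
    [exact: sub_cell_meet cp|exact: sub_cell_meet cq|].
  case/predU1P=> [->|]; last exact: pq.
  move: cp cq; rewrite /cell /= !lexI.
  by case/andP=> /andP[_ ->] _ /andP[/andP[_ ->]].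
- apply: IH => p q cp cq pq; apply: dA => [||z].
  + by move: cp; rewrite cell_cons => -[].
  + by move: cq; rewrite cell_cons => -[].
  case/predU1P=> [->|]; last exact: pq.
  move: cp cq; rewrite /cell /= !negb_or.
  by case/and3P=> _ /negPf-> _ /and3P[_ /negPf->].
Qed.

Lemma ring_ind A : <<r range (@ideal _ X) >> A -> P A.
Proof.
move=> /ring_decided[t [dA bA]].
(* The list [s] holds the ideals already removed from [A], and [u] those still available to cover
   the rest. Moving [x] from [u] to [s] splits off [A] intersected with [cell x s]; when [u] is
   empty nothing is left. *)
suff H u s : (forall p, A p -> has (fun y => (p <= y)%O) (s ++ u)) ->
    P (A `&` [set p | ~~ has (fun y => (p <= y)%O) s]).
  have -> : A = A `&` [set p | ~~ has (fun y => (p <= y)%O) [::]]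
    by apply/seteqP; split=> p // [].
  exact: (H t [::] bA).
elim: u s => [|x u IH] s bs.
  suff -> : A `&` [set p | ~~ has (fun y => (p <= y)%O) s] = set0 by [].
  apply/seteqP; split=> // p [/bs]; rewrite cats0 /= => ->.
  by [].
have -> : A `&` [set p | ~~ has (fun y => (p <= y)%O) s] =
  (A `&` cell x s) `|` (A `&` [set p | ~~ has (fun y => (p <= y)%O) (x :: s)]).
  rewrite -setIUr; congr (_ `&` _); apply/seteqP; split=> p; rewrite /cell /=.
    by rewrite negb_or; case: (p <= x)%O => /= h; [left|right].
  by rewrite negb_or => -[/andP[]|/andP[]].
apply: PU.
- apply/seteqP; split=> // p [[_ /andP[px _]] [_ /=]].
  by rewrite px.
- by apply: (@P_cell_decided t) => p q _ _; apply: dA.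
- apply: IH => p /bs; rewrite !has_cat /=.
  by case: (p <= x)%O; rewrite ?orbT.
Qed.

End RingInd.
End Cells.

(** * Integer combinations of indicators of ideals *)

Section Combinations.
Context {d : Order.disp_t} {X : meetSemilatticeType d}.
Implicit Types (x p : X) (c : seq (int * X)).

(** The list [c] is a formal integer combination of elements of [X], with repetitions allowed. The
    group [V] varies so that the same [c] can be evaluated on indicators in [int] and on [f] in
    [G]. *)
Definition lin {V : zmodType} c (g : X -> V) : V :=
  \sum_(kx <- c) g kx.2 *~ kx.1.

Definition oppc c : seq (int * X) := [seq (- kx.1, kx.2) | kx <- c].

(** With this argument, [lin c] is the value at the point [p] of the combination [c] of indicators
    of ideals. *)
Definition below p : X -> int := fun x => (p <= x)%O%:R.

Lemma lin_cat (V : zmodType) c1 c2 (g : X -> V) :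
  lin (c1 ++ c2) g = lin c1 g + lin c2 g.
Proof. exact: big_cat. Qed.

Lemma lin_opp (V : zmodType) c (g : X -> V) : lin (oppc c) g = - lin c g.
Proof.
by rewrite /lin big_map -sumrN; apply: eq_bigr => kx _; rewrite mulrNz.
Qed.

(** A new head lying above the maximal element already found replaces it; any other head leaves it
    maximal. *)
Lemma seq_maximal (x0 : X) (s : seq X) :
  exists2 x, x \in x0 :: s & forall y, y \in x0 :: s -> (x <= y)%O -> y = x.
Proof.
elim: s x0 => [|z s IH] x0.
  by exists x0; rewrite ?mem_head // => y; rewrite inE => /eqP.
have [x xs mx] := IH z.
have [xx0|nxx0] := boolP (x <= x0)%O.
  exists x0; first exact: mem_head.
  move=> y; rewrite inE => /predU1P[//|ys] x0y.
  have yx := mx y ys (le_trans xx0 x0y).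
  by apply/eqP; rewrite eq_le x0y yx xx0.
exists x; first by rewrite inE xs orbT.
move=> y; rewrite inE => /predU1P[-> h|]; last exact: mx.
by rewrite h in nxx0.
Qed.

(** Strong induction on the length of [c]: the total coefficient of a maximal entry vanishes, so all
    pairs carrying that entry can be deleted without changing any evaluation. *)
Lemma lin_eq0 (V : zmodType) c (g : X -> V) :
  (forall p, lin c (below p) = 0) -> lin c g = 0.
Proof.
have [n] := ubnP (size c); elim: n c => // n IH [|kx0 c0] szc c0P.
  exact: big_nil.
set c := kx0 :: c0 in szc c0P *.
have [x xc mx] := seq_maximal kx0.2 [seq kx.2 | kx <- c0].
rewrite -[_ :: _]/[seq kx.2 | kx <- c] in xc mx.
pose c' := [seq kx <- c | kx.2 != x].
have linE (W : zmodType) (h : X -> W) :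
    lin c h = h x *~ (\sum_(kx <- c | kx.2 == x) kx.1) + lin c' h.
  rewrite /lin (bigID (fun kx => kx.2 == x)) /=; congr (_ + _).
    by rewrite mulrz_sumr; apply: eq_bigr => kx /eqP->.
  by rewrite big_filter.
(* Evaluation at the point [x]: by maximality no other entry of [c] lies above [x], so only the
   total coefficient of [x] survives. *)
have k0 : \sum_(kx <- c | kx.2 == x) kx.1 = 0.
  have := c0P x; rewrite linE {1}/below lexx.
  suff -> : lin c' (below x) = 0 by rewrite addr0 intz.
  rewrite /lin big1_seq // => kx /=; rewrite mem_filter => /andP[nx kxc].
  rewrite /below; case: (boolP (x <= kx.2)%O) => [/mx|_]; last exact: mul0rz.
  by rewrite map_f // => /(_ isT) /eqP; rewrite (negPf nx).
have linE0 (W : zmodType) (h : X -> W) : lin c h = lin c' h.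
  by rewrite linE k0 mulr0z add0r.
rewrite linE0; apply: IH => [|p]; last by rewrite -linE0.
rewrite -ltnS; apply: leq_trans szc.
rewrite ltnS size_filter -(count_predC (fun kx => kx.2 == x)).
rewrite -[X in (X < _)%N]add0n ltn_add2r -has_count.
by case/mapP: xc => kx kxc ->; apply/hasP; exists kx => /=.
Qed.

(** By induction over the ring: [cell_cons] makes the indicator of a cell a difference of two, and a
    disjoint union adds indicators. *)
Lemma ring_lin (A : set X) : <<r range (@ideal _ X) >> A ->
  exists c, forall p, lin c (below p) = (p \in A)%:R.
Proof.
pose P (B : set X) := exists c, forall p, lin c (below p) = (p \in B)%:R.
apply: (@ring_ind _ _ P) => [|x s|A1 A2 A12 [c1 h1] [c2 h2]].
- by exists [::] => p; rewrite /lin big_nil in_set0.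
- elim: s x => [|y s IH] x.
    exists [:: (1, x)] => p; rewrite /lin big_seq1 /= cell_nil /below.
    congr (_%:R); congr nat_of_bool.
    by apply/idP/idP => [px|/set_mem/idealP//]; apply/mem_set/idealP.
  have [c1 h1] := IH x; have [c2 h2] := IH (x `&` y)%O.
  exists (c1 ++ oppc c2) => p; rewrite lin_cat lin_opp h1 h2 cell_cons in_setD.
  case: (boolP (p \in cell (x `&` y)%O s)) => [pc|_]; last first.
    by rewrite subr0 andbT.
  by rewrite (mem_set (sub_cell_meet (set_mem pc))) subrr.
- exists (c1 ++ c2) => p; rewrite lin_cat h1 h2 in_setU.
  case: (boolP (p \in A1)) => [p1|_]; last by rewrite add0r.
  case: (boolP (p \in A2)) => [p2|_]; last by rewrite addr0.
  suff : (set0 : set X) p by [].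
  by rewrite -A12; split; apply: set_mem.
Qed.

End Combinations.

(** * Modular functions on the ring of sets as valuations *)

Section Valuations.
Context {d : Order.disp_t} {X : meetSemilatticeType d} {G : zmodType}.
Implicit Types (A B : ringR X) (s : seq (ringR X)).

Lemma incl_excl_enum {d' : Order.disp_t} {Y : meetSemilatticeType d'}
    (f : Y -> G) N (y : 'I_N -> Y) :
  incl_excl f y = ie_rec f [seq y i | i <- enum 'I_N].
Proof.
elim: N f y => [|N IH] f y; last first.
  by rewrite incl_exclS enum_ordSl /= -map_comp !IH.
rewrite (@incl_excl_ext _ _ _ f _ _ (tnth (in_tuple [::]))) => [|[]//].
rewrite incl_excl_rec; suff -> : enum 'I_0 = [::] by [].
by apply: size0nil; rewrite size_enum_ord.
Qed.

Lemma ie_rec_map {d1 d2 : Order.disp_t} {Y : meetSemilatticeType d1}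
    {Z : meetSemilatticeType d2} (h : Y -> Z) (f : Z -> G) (s : seq Y) :
  {morph h : x y / (x `&` y)%O} -> ie_rec f (map h s) = ie_rec (f \o h) s.
Proof.
move=> hI; elim: s f => //= x s IH f; rewrite !IH; congr (_ - _).
by apply: ie_rec_ext => z /=; rewrite hI.
Qed.

Fact ring0 : set0 \in @ring_pred _ X.
Proof. by apply/ring_predP; apply: setring0. Qed.

Definition emptyR : ringR X := RingR ring0.

Definition unionR s : ringR X := foldr Order.join emptyR s.

Lemma unionRE s p :
  ringR_val (unionR s) p <-> exists2 A : ringR X, A \in s & (A : set X) p.
Proof.
elim: s => [|A s IH] /=; first by split=> [|[]].
split=> [[Ap|/IH[B Bs Bp]]|[B]].
- by exists A; rewrite ?mem_head.
- by exists B; rewrite // inE Bs orbT.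
- by rewrite inE => /predU1P[-> ?|Bs Bp]; [left|right; apply/IH; exists B].
Qed.

Lemma unionR_sup s (u : ringR X) : supremums [set` s] u -> u = unionR s.
Proof.
case=> ub lub; apply/eqP; rewrite eq_le; apply/andP; split.
  apply: lub => A As; apply/ringR_leE => p Ap; apply/unionRE; exists A => //.
apply/ringR_leE => p /unionRE[A As Ap].
by have /ringR_leE := ub A As; apply.
Qed.

(** The two-set form of modularity; the normalization at [emptyR] is its case of an empty family. *)
Definition valuation (m : ringR X -> G) :=
  m emptyR = 0 /\ forall A B, m (A `|` B)%O = m A + m B - m (A `&` B)%O.

(** The induction must quantify over [m]: the recursion of [ie_rec] passes to the function sending
    [B] to [m] of the intersection of [A] and [B], which is again a valuation by distributivity. *)
Lemma valuation_unionR (m : ringR X -> G) s :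
  valuation m -> ie_rec m s = m (unionR s).
Proof.
elim: s m => [|A s IH] m [m0 mU] /=; first by rewrite m0.
rewrite mU !IH //; split.
  suff -> : (A `&` emptyR)%O = emptyR by [].
  by apply: val_inj; apply: setI0.
move=> B C.
have -> : (A `&` (B `|` C))%O = ((A `&` B) `|` (A `&` C))%O.
  by apply: val_inj; apply: setIUr.
rewrite mU; congr (_ - m _).
by apply: val_inj; rewrite /= [LHS]setIACA setIid.
Qed.

(** Families of length 0 and 2 give the valuation laws. Conversely, a least upper bound of a finite
    family in the ring is its union, where inclusion-exclusion holds. *)
Lemma modular_valuation (m : ringR X -> G) : modular m <-> valuation m.
Proof.
split=> [mm|vm N y u yu].
  have mE s u : supremums [set` s] u -> m u = ie_rec m s.
    move=> su; rewrite -incl_excl_rec; apply: mm; congr (supremums _ _): su.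
    apply/seteqP; split=> [A /= As|_ [i _ <-]]; last exact: mem_tnth.
    by have /tnthP[i ->] : A \in in_tuple s; [|exists i].
  split; first by apply: (mE [::]); split=> // A _; apply/ringR_leE.
  move=> A B; rewrite (mE [:: A; B]) /= ?subr0 ?addr0 //; split.
    move=> C /=; rewrite !inE => /orP[] /eqP-> p ?; by [left|right].
  move=> D uD; suff : (A `|` B <= D)%O by [].
  by rewrite leUx !uD //= !inE eqxx ?orbT.
rewrite incl_excl_enum valuation_unionR //; congr m; apply: unionR_sup.
congr (supremums _ _): yu; apply/seteqP.
split=> [_ [i _ <-]|A /= /mapP[i _ ->]].
  by rewrite /= map_f // mem_enum.
by exists i.
Qed.

Lemma modular_funP (mu : modular_fun (ringR X) G) : valuation mu.
Proof. by apply/modular_valuation/asboolP; case: mu. Qed.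

Lemma valuation_disjoint (m : ringR X -> G) A B C : valuation m ->
  A `&` B = set0 :> set X -> ringR_val C = A `|` B -> m C = m A + m B.
Proof.
move=> [m0 mU] AB0 CE; have -> : C = (A `|` B)%O by apply: val_inj.
have -> := mU A B; suff -> : (A `&` B)%O = emptyR by rewrite m0 subr0.
exact: val_inj.
Qed.

Lemma valuation_diff (m : ringR X -> G) A B C : valuation m ->
  B `<=` A -> ringR_val C = A `\` B -> m C = m A - m B.
Proof.
move=> vm BA CE; apply/esym/eqP; rewrite subr_eq addrC; apply/eqP.
apply: (valuation_disjoint vm); rewrite CE.
  by rewrite setDE setICA setICr setI0.
by rewrite setUC setDKU.
Qed.

Lemma idealR_meet : {morph @idealR _ X : x y / (x `&` y)%O}.
Proof.
move=> x y; apply: val_inj; apply/seteqP; split=> p.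
  by move=> /idealP; rewrite lexI => /andP[px py]; split; apply/idealP.
by case=> /idealP px /idealP py; apply/idealP; rewrite lexI px.
Qed.

Lemma unionR_idealP (s : seq X) p :
  ringR_val (unionR (map (@idealR _ X) s)) p <-> has (fun y => (p <= y)%O) s.
Proof.
split=> [/unionRE[_ /mapP[y ys ->] /idealP py]|/hasP[y ys py]].
  by apply/hasP; exists y.
by apply/unionRE; exists (idealR y); [exact: map_f|apply/idealP].
Qed.

Lemma valuation_ideals (m : ringR X -> G) f (s : seq X) : valuation m ->
  (forall x, m (idealR x) = f x) ->
  m (unionR (map (@idealR _ X) s)) = ie_rec f s.
Proof.
move=> vm mf; rewrite -valuation_unionR // ie_rec_map; last exact: idealR_meet.
exact: ie_rec_ext.
Qed.

Lemma valuation_bigcup (m : ringR X -> G) f (s : seq X)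
    (fs : finite_set [set` s]) :
  valuation m -> (forall x, m (idealR x) = f x) ->
  m (bigcup_idealR fs) = ie_rec f s.
Proof.
move=> vm mf; rewrite -(valuation_ideals _ vm mf); congr m; apply: val_inj.
apply/seteqP; split=> p.
  by case=> y ys /idealP py; apply/unionR_idealP/hasP; exists y.
by move=> /unionR_idealP/hasP[y ys py]; exists y => //; apply/idealP.
Qed.

(** Valuations are subtractive on nested sets, so [cell_cons] reduces their values on cells to those
    on ideals. *)
Lemma valuation_inj (m1 m2 : ringR X -> G) : valuation m1 -> valuation m2 ->
  (forall x, m1 (idealR x) = m2 (idealR x)) -> m1 =1 m2.
Proof.
move=> v1 v2 e12 [A RA].
(* [ring_ind] speaks of bare sets, so the membership proof is packed into the predicate; proof
   irrelevance then recovers the given element of the ring. *)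
pose P (B : set X) := exists RB : B \in @ring_pred _ X,
  m1 (RingR RB) = m2 (RingR RB).
suff [RA' e] : P A by rewrite (bool_irrelevance RA RA').
apply: ring_ind (ring_predP _ RA) => [|x s|B C BC [RB eB] [RC eC]].
- by exists ring0; case: v1 => + _; case: v2 => + _; rewrite /emptyR => -> ->.
- exists (cell_in_ring x s); elim: s x => [|y s IH] x.
    have -> : RingR (cell_in_ring x [::]) = idealR x.
      by apply: val_inj; apply: cell_nil.
    exact: e12.
  have sxy := @sub_cell_meet _ _ x y s.
  have cE (m : ringR X -> G) : valuation m ->
      m (RingR (cell_in_ring x (y :: s))) =
      m (RingR (cell_in_ring x s)) - m (RingR (cell_in_ring (x `&` y)%O s)).
    by move=> vm; apply: (@valuation_diff _ (RingR (cell_in_ring x s))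
      (RingR (cell_in_ring (x `&` y)%O s))) => //; apply: cell_cons.
  by rewrite !cE ?IH.
- exists (ring_predU RB RC).
  have UE (m : ringR X -> G) : valuation m ->
      m (RingR (ring_predU RB RC)) = m (RingR RB) + m (RingR RC).
    by move=> vm; exact: (@valuation_disjoint _ (RingR RB) (RingR RC)).
  by rewrite !UE ?eB ?eC.
Qed.

(** For each [A] a combination [c A] representing its indicator is chosen, and [m A] evaluates it on
    [f]. Each required identity becomes the vanishing of one combination of indicators, so [lin_eq0]
    applies. *)
Lemma valuation_exists (f : X -> G) :
  exists2 m : ringR X -> G, valuation m & forall x, m (idealR x) = f x.
Proof.
have [c cP] : {c : ringR X -> seq (int * X) &
    forall A p, lin (c A) (below p) = (p \in (A : set X))%:R}.
  apply: (@choice _ _ (fun A (cA : seq (int * X)) =>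
    forall p, lin cA (below p) = (p \in (A : set X))%:R)) => -[A RA].
  exact: ring_lin (ring_predP _ RA).
exists (fun A => lin (c A) f).
  split=> [|A B].
    by apply: lin_eq0 => p; rewrite cP in_set0.
  apply/eqP; rewrite -subr_eq0 -!lin_opp -!lin_cat -lin_opp -lin_cat; apply/eqP.
  apply: lin_eq0 => p; rewrite lin_cat lin_opp !lin_cat lin_opp !cP.
  rewrite ringR_meetE ringR_joinE in_setU in_setI.
  by case: (p \in _); case: (p \in _).
move=> x; apply/eqP; rewrite -subr_eq0; apply/eqP.
have -> : f x = lin [:: (1, x)] f by rewrite /lin big_seq1.
rewrite -lin_opp -lin_cat; apply: lin_eq0 => p.
rewrite lin_cat lin_opp cP /lin big_seq1 /= /below.
suff -> : (p \in ideal x) = (p <= x)%O by rewrite subrr.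
by apply/idP/idP => [/set_mem/idealP//|px]; apply/mem_set/idealP.
Qed.

End Valuations.

(** * The group isomorphism given by restriction to ideals *)

Section Restriction.
Context {d : Order.disp_t} {X : meetSemilatticeType d} {G : zmodType}.

Definition ideal_values (mu : modular_fun (ringR X) G) : X -> G :=
  fun x => mu (idealR x).

Fact ideal_values_additive : zmod_morphism ideal_values.
Proof. by move=> mu1 mu2; apply/funext. Qed.

HB.instance Definition _ :=
  GRing.isZmodMorphism.Build _ _ ideal_values ideal_values_additive.

Lemma ideal_values_bij : bijective ideal_values.
Proof.
have inj : injective ideal_values.
  move=> mu1 mu2 e; apply: val_inj; apply/funext.
  apply: valuation_inj; try exact: modular_funP.
  by move=> x; rewrite -[LHS]/(ideal_values mu1 x) e.
have surj (f : X -> G) : {mu | ideal_values mu = f}.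
  apply: cid; have [m vm mf] := valuation_exists f.
  have mm : m \in @modular_pred _ (ringR X) G.
    exact/asboolP/modular_valuation.
  by exists (ModularFun mm); apply/funext.
exists (fun f => sval (surj f)) => [mu|f]; last exact: svalP (surj f).
by apply: inj; apply: svalP (surj _).
Qed.

End Restriction.

(** * Modularity of [f] and positivity of the valuation *)

Lemma modular_ideals {d : Order.disp_t} {X : meetSemilatticeType d}
    {G : zmodType} (m : ringR X -> G) (f : X -> G) :
  valuation m -> (forall x, m (idealR x) = f x) ->
  modular f <-> forall (a : set X) (fa : finite_set a) (s : X),
    supremums a s -> m (bigcup_idealR fa) = m (idealR s).
Proof.
move=> vm mf; split=> [fm a fa s|H N y u yu].
  (* On the union of the ideals of a finite list, [m] equals the inclusion-exclusion sum of [f] over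
     that list. Both directions use this to identify the two conditions. *)
  have /finite_seqP[t at_] := fa; subst a => ts.
  rewrite (valuation_bigcup fa vm mf) mf -incl_excl_rec; apply/esym/fm.
  congr (supremums _ _): ts; apply/seteqP; split=> [x /= xt|_ [i _ <-]].
    by have /tnthP[i ->] : x \in in_tuple t; [|exists i].
  exact: mem_tnth.
have yE : range y = [set` [seq y i | i <- enum 'I_N]].
  apply/seteqP; split=> [_ [i _ <-]|x /= /mapP[i _ ->]]; last by exists i.
  by rewrite /= map_f // mem_enum.
rewrite yE in yu; have fs := finite_seq [seq y i | i <- enum 'I_N].
by rewrite -mf -(H _ fs _ yu) (valuation_bigcup fs vm mf) incl_excl_enum.
Qed.

(** Ring sets are built from cells by disjoint unions, so positivity need only be tested on cells,
    where it is an inequality between [canonical_rep f] and [f]. *)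
Lemma positive_ideals {d : Order.disp_t} {X : meetSemilatticeType d}
    {G : zmodType} (m : ringR X -> G) (f : X -> G) (le : rel G) :
  partially_ordered_group le -> valuation m ->
  (forall x, m (idealR x) = f x) ->
  (forall A, le 0 (m A)) <->
  (forall (xi : Xi X) (x : X),
     (xi <= Xi_class [:: x])%O -> le (canonical_rep f xi) (f x)).
Proof.
case=> le_refl _ le_tr leD vm mf.
have le_sub a b : le 0 (b - a) <-> le a b.
  by split=> [/(leD _ _ a)|/(leD _ _ (- a))]; rewrite ?subrK ?add0r ?subrr.
(* Each removed ideal is first cut down to [I(x /\ y)], so that the removed union lies inside
   [I(x)], as [valuation_diff] demands. *)
have cellE x s : m (RingR (cell_in_ring x s)) =
    f x - ie_rec f [seq (x `&` y)%O | y <- s].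
  rewrite -mf -(valuation_ideals _ vm mf); apply: valuation_diff => //.
    move=> p /unionR_idealP/hasP[_ /mapP[y ys ->]]; rewrite lexI => /andP[px _].
    exact/idealP.
  apply/seteqP; split=> p.
    case/andP=> px ns; split; first exact/idealP.
    move=> /unionR_idealP/hasP[_ /mapP[y ys ->]]; rewrite lexI px /= => py.
    by case/hasP: ns; exists y.
  case=> /idealP px ns; apply/andP; split=> //; apply/hasP => -[y ys py].
  apply: ns; apply/unionR_idealP/hasP; exists (x `&` y)%O; first exact: map_f.
  by rewrite lexI px.
split=> [m_ge0 xi x|H [A RA]].
  have : xi = Xi_class (repr xi) by rewrite /Xi_class reprK.
  move: (repr xi) => s ->; rewrite Xi_class_le => sx; apply/le_sub.
  rewrite canonical_repE incl_excl_rec.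
  (* All entries of [s] lie below [x], so meeting them with [x] changes nothing and the difference
     is the value of [m] on [cell x s]. *)
  suff <- : [seq (x `&` y)%O | y <- s] = s by rewrite -cellE.
  rewrite -[RHS]map_id; apply/eq_in_map => y /(allP sx).
  by rewrite /= orbF => /meet_idPr.
pose P (B : set X) := exists RB : B \in @ring_pred _ X, le 0 (m (RingR RB)).
suff [RA' e] : P A by rewrite (bool_irrelevance RA RA').
apply: ring_ind (ring_predP _ RA) => [|x s|B C BC [RB leB] [RC leC]].
- by exists ring0; case: vm => + _; rewrite /emptyR => ->.
- exists (cell_in_ring x s); rewrite cellE; apply/le_sub.
  rewrite -incl_excl_rec -canonical_repE; apply: H; rewrite Xi_class_le.
  by apply/allP => _ /mapP[y _ ->] /=; rewrite leIl.
- exists (ring_predU RB RC).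
  rewrite (@valuation_disjoint _ _ _ _ (RingR RB) (RingR RC) _ vm) //.
  by apply: le_tr leC _; rewrite -{1}[m (RingR RC)]add0r; apply: leD.
Qed.

Theorem theorem4 (d : Order.disp_t) (X : meetSemilatticeType d)
    (G : zmodType) :
  (exists Phi : {additive modular_fun (ringR X) G -> (X -> G)},
     bijective Phi /\
     forall (mu : modular_fun (ringR X) G) (f : X -> G),
       Phi mu = f <-> (forall x : X, mu (idealR x) = f x)) /\
  (forall (mu : modular_fun (ringR X) G) (f : X -> G),
     (forall x : X, mu (idealR x) = f x) ->
     (modular f <->
      forall (a : set X) (fa : finite_set a) (s : X),
        supremums a s -> mu (bigcup_idealR fa) = mu (idealR s)) /\
     (forall le : rel G, partially_ordered_group le ->
        ((forall A : ringR X, le 0 (mu A)) <->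
         (forall (xi : Xi X) (x : X),
            (xi <= Xi_class [:: x])%O -> le (canonical_rep f xi) (f x))))).
Proof.
split.
  exists (@ideal_values d X G); split; first exact: ideal_values_bij.
  by move=> mu f; split=> [<- //|e]; apply/funext.
move=> mu f mf; have vmu := modular_funP mu; split.
  exact: modular_ideals vmu mf.
by move=> le ple; apply: positive_ideals ple vmu mf.
Qed.
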